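(* Let $\nu$ be a probability measure on a measurable space $S$ and let $\mathcal{L}$ be a Markov generator which is self-adjoint in $L^2(\nu)$, with domain $\mathcal{D}(\mathcal{L})$. Let $\mathcal{E}(f,f) := -\nu[f\mathcal{L}f]$ for $f \in \mathcal{D}(\mathcal{L})$. Then the spectral gap $\mathrm{gap}(\mathcal{L})$ is equal to the largest constant $k$ such that the inequality $$k\,\mathcal{E}(f,f) \leq \nu\left[(\mathcal{L}f)^2\right]$$ holds true for every $f \in \mathcal{D}(\mathcal{L})$.
   Context: $\nu[f] := \int f\,d\nu$ and $\nu[f;g] := \nu[fg]-\nu[f]\nu[g]$. The operator $\mathcal{L}$ is the self-adjoint generator of the semigroup $T_tf(x)=E[f(X_t)\mid X_0=x]$ of a Markov process $(X_t)_{t\ge 0}$ on $S$ with invariant measure $\nu$, whose equilibrium dynamics are time-homogeneous and time-reversible in law; $(T_t)$ is a semigroup of self-adjoint, positivity preserving contractions on $L^2(\nu)$. The spectral gap $\mathrm{gap}(\mathcal{L})$ is the largest $k \geq 0$ such that the Poincaré inequality $k\,\nu[f;f] \leq \mathcal{E}(f,f)$ holds for every $f \in \mathcal{D}(\mathcal{L})$.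
   Formalization: Ergodicity is added: if Lf = 0 ν-a.e. then f is ν-a.e. constant. Without it the claim fails: for L = 0 on two points the gap is 0 but every k satisfies the second inequality. ''Largest'' may be +∞ when every k is admissible. *)

(* Defs.v *)
From HB Require Import structures.
From mathcomp Require Import all_boot all_order all_algebra.
From mathcomp Require Import all_classical all_reals all_analysis.
Set Implicit Arguments.
Unset Strict Implicit.
Unset Printing Implicit Defensive.
Import Order.TTheory GRing.Theory Num.Theory.
Import numFieldNormedType.Exports.
Local Open Scope classical_set_scope.
Local Open Scope ring_scope.

(* Elements of L^2(nu) are represented by functions f \in Lfun nu 2%:E.
   Operators on L^2(nu) act on representatives, and every identity between
   elements of L^2(nu) is stated up to nu-a.e. equality. *)

Definition mean d (S : measurableType d) (R : realType) (nu : probability S R)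
  (f : S -> R) : R := \int[nu]_x f x.

Definition cov d (S : measurableType d) (R : realType) (nu : probability S R)
  (f g : S -> R) : R := mean nu (f \* g) - mean nu f * mean nu g.

Definition sqnorm d (S : measurableType d) (R : realType)
  (nu : probability S R) (f : S -> R) : R := mean nu (fun x => f x ^+ 2).

(* The operators T t matter only for 0 <= t. *)
Record markov_semigroup d (S : measurableType d) (R : realType)
    (nu : probability S R) (T : R -> (S -> R) -> S -> R) : Prop := {
  ms_L2 : forall t f, 0 <= t ->
    f \in Lfun nu 2%:E -> T t f \in Lfun nu 2%:E ;
  ms_ae : forall t f g, 0 <= t ->
    f \in Lfun nu 2%:E -> g \in Lfun nu 2%:E ->
    ae_eq nu setT f g -> ae_eq nu setT (T t f) (T t g) ;
  ms_linear : forall t a f g, 0 <= t ->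
    f \in Lfun nu 2%:E -> g \in Lfun nu 2%:E ->
    ae_eq nu setT (T t (fun x => a * f x + g x))
                  (fun x => a * T t f x + T t g x) ;
  ms_positive : forall t f, 0 <= t -> f \in Lfun nu 2%:E ->
    {ae nu, forall x, 0 <= f x} -> {ae nu, forall x, 0 <= T t f x} ;
  ms_contraction : forall t f, 0 <= t -> f \in Lfun nu 2%:E ->
    sqnorm nu (T t f) <= sqnorm nu f ;
  ms_selfadjoint : forall t f g, 0 <= t ->
    f \in Lfun nu 2%:E -> g \in Lfun nu 2%:E ->
    mean nu (T t f \* g) = mean nu (f \* T t g) ;
  ms_one : forall t, 0 <= t -> ae_eq nu setT (T t (cst 1)) (cst 1) ;
  ms_zero : forall f, f \in Lfun nu 2%:E -> ae_eq nu setT (T 0 f) f ;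
  ms_add : forall s t f, 0 <= s -> 0 <= t -> f \in Lfun nu 2%:E ->
    ae_eq nu setT (T (s + t) f) (T s (T t f)) ;
  ms_continuous : forall f, f \in Lfun nu 2%:E ->
    sqnorm nu (T t f \- f) @[t --> 0^'+] --> (0 : R)
}.

(* [gen_limit nu T f g]: (T_t f - f) / t converges to g in L^2(nu) as t
   decreases to 0. *)
Definition gen_limit d (S : measurableType d) (R : realType)
    (nu : probability S R) (T : R -> (S -> R) -> S -> R) (f g : S -> R) : Prop :=
  [/\ f \in Lfun nu 2%:E, g \in Lfun nu 2%:E &
      sqnorm nu (fun x => (T t f x - f x) / t - g x) @[t --> 0^'+] --> (0 : R)].

(* [D] is the domain of the operator [L]; the values of [L] outside [D] are
   irrelevant. *)
Definition markov_generator d (S : measurableType d) (R : realType)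
    (nu : probability S R) (D : set (S -> R)) (L : (S -> R) -> S -> R) : Prop :=
  exists2 T, markov_semigroup nu T &
    (forall f, D f <-> exists g, gen_limit nu T f g) /\
    (forall f, D f -> gen_limit nu T f (L f)).

Definition densely_defined d (S : measurableType d) (R : realType)
    (nu : probability S R) (D : set (S -> R)) : Prop :=
  forall f e, f \in Lfun nu 2%:E -> 0 < e ->
    exists2 h, D h & sqnorm nu (f \- h) < e.

(* The graph of the adjoint of the unbounded operator (D, L). *)
Definition adjoint_graph d (S : measurableType d) (R : realType)
    (nu : probability S R) (D : set (S -> R)) (L : (S -> R) -> S -> R)
    (f g : S -> R) : Prop :=
  [/\ f \in Lfun nu 2%:E, g \in Lfun nu 2%:E &
      forall h, D h -> mean nu (f \* L h) = mean nu (g \* h)].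

Definition self_adjoint d (S : measurableType d) (R : realType)
    (nu : probability S R) (D : set (S -> R)) (L : (S -> R) -> S -> R) : Prop :=
  densely_defined nu D /\
  forall f g, adjoint_graph nu D L f g <->
    [/\ D f, g \in Lfun nu 2%:E & ae_eq nu setT g (L f)].

(* 0 is a simple eigenvalue. Without this the two constants may differ: if
   L = 0 on a two-point space, the spectral gap is 0 but every k satisfies
   k E(f,f) <= nu[(L f)^2]. *)
Definition ergodic d (S : measurableType d) (R : realType)
    (nu : probability S R) (D : set (S -> R)) (L : (S -> R) -> S -> R) : Prop :=
  forall f, D f -> ae_eq nu setT (L f) (cst 0) ->
    exists c, ae_eq nu setT f (cst c).

Definition dirichlet d (S : measurableType d) (R : realType)
    (nu : probability S R) (L : (S -> R) -> S -> R) (f : S -> R) : R :=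
  - mean nu (f \* L f).

(* [largest_constant A k]: k is the largest element of A, where k = +oo means
   that A is unbounded above. *)
Definition largest_constant (R : realType) (A : set R) (k : \bar R) : Prop :=
  ereal_sup (EFin @` A) = k /\ (k \is a fin_num -> A (fine k)).

Definition poincare_constants d (S : measurableType d) (R : realType)
    (nu : probability S R) (D : set (S -> R)) (L : (S -> R) -> S -> R) : set R :=
  [set k | 0 <= k /\ forall f, D f -> k * cov nu f f <= dirichlet nu L f].

(* The supremum is a maximum when finite (lemma [spectral_gap_largest]); it is
   +oo exactly when every k >= 0 is admissible, e.g. for a Dirac mass. *)
Definition spectral_gap d (S : measurableType d) (R : realType)
    (nu : probability S R) (D : set (S -> R)) (L : (S -> R) -> S -> R) : \bar R :=
  ereal_sup (EFin @` poincare_constants nu D L).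

Lemma spectral_gap_largest d (S : measurableType d) (R : realType)
    (nu : probability S R) (D : set (S -> R)) (L : (S -> R) -> S -> R) :
  (forall f, D f -> 0 <= dirichlet nu L f) ->
  largest_constant (poincare_constants nu D L) (spectral_gap nu D L).
Proof.
move=> E0; split => // gfin.
have A0 : poincare_constants nu D L 0.
  by split => // f Df; rewrite mul0r; exact: E0.
have ub k : poincare_constants nu D L k -> k <= fine (spectral_gap nu D L).
  by move=> Ak; rewrite -lee_fin fineK//; apply: ereal_sup_ubound; exists k.
split; first exact: ub.
move=> f Df; set g := fine _.
have [V0|V0] := leP (cov nu f f) 0.
  by apply: le_trans (E0 f Df); rewrite mulr_ge0_le0// /g; exact: ub.
rewrite -ler_pdivlMr// -lee_fin /g fineK//.
apply: ge_ereal_sup => _ [k [_ Ak] <-].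
by rewrite lee_fin ler_pdivlMr//; exact: Ak.
Qed.

(* Main.v *)
(* Write [E(u, v) = - nu[u L v]]; it is symmetric and nonnegative on the domain.

   If [k] is a Poincare constant and [nu f = 0], then
   [E(f, f) ^ 2 <= nu[f ^ 2] nu[(L f) ^ 2]] by Cauchy-Schwarz, whence
   [k E(f, f) <= nu[(L f) ^ 2]].

   Conversely assume [k E(g, g) <= nu[(L g) ^ 2]] on the domain.  If [h = L g]
   is itself in the domain, then [nu[h ^ 2] = - E(g, h)], so Cauchy-Schwarz for
   [E] gives [nu[h ^ 2] ^ 2 <= E(g, g) E(h, h) <= nu[h ^ 2] E(h, h) / k]: the
   Poincare inequality holds for [h].  Every centered [f] of the domain is
   approximated by such [h]: projecting [(0, f)] onto the graph of [L] for the
   norm [c |g| ^ 2 + |h| ^ 2] yields [(g, h)] such that [b = f - h] satisfies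
   [L b = c g].  Then [h] is in the domain, and [E(h, h) <= E(f, f)] because
   [E(h, b) = c E(g, g) >= 0].  Ergodicity makes the range of [L] dense among
   centered functions, hence [b] tends to [0] with [c].  This uses neither the
   spectral theorem nor differentiation along the semigroup; the only analytic
   input is the completeness of [L^2]. *)
Require Import Defs.
From HB Require Import structures.
From mathcomp Require Import all_boot all_order all_algebra.
From mathcomp Require Import all_classical all_reals all_analysis.
From mathcomp Require Import measurable_realfun ring lra.
Set Implicit Arguments.
Unset Strict Implicit.
Unset Printing Implicit Defensive.
Import Order.TTheory GRing.Theory Num.Theory.
Import numFieldNormedType.Exports.
Local Open Scope classical_set_scope.
Local Open Scope ring_scope.

(** * Semi-inner products and orthogonal projection *)

(** For [a > 0], evaluate at the minimizer [- b / a]; for [a = 0], a nonzero slope [b] would give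
    the value [-1] at [- (c + 1) / (2 * b)]. *)
Lemma discriminant_le (R : realFieldType) (a b c : R) : 0 <= a ->
  (forall t, 0 <= c + 2 * t * b + t ^+ 2 * a) -> b ^+ 2 <= a * c.
Proof.
rewrite le_eqVlt => /predU1P[<-|a0] H.
  rewrite mul0r; have [->|b0] := eqVneq b 0; first by rewrite expr0n.
  have := H (- (c + 1) / (2 * b)).
  suff -> : c + 2 * (- (c + 1) / (2 * b)) * b + (- (c + 1) / (2 * b)) ^+ 2 * 0
    = -1 by lra.
  by field.
have := H (- b / a).
have -> : c + 2 * (- b / a) * b + (- b / a) ^+ 2 * a = (a * c - b ^+ 2) / a.
  by field; rewrite gt_eqF.
by rewrite pmulr_lge0 ?invr_gt0// subr_ge0.
Qed.

Lemma le0_geometric (R : realType) (x C : R) :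
  (forall n, x <= C / 4 ^+ n) -> x <= 0.
Proof.
move=> H; rewrite leNgt; apply/negP => x0.
have [n nC] : exists n : nat, C / x < n%:R.
  exists (Num.bound `|C / x|).
  exact: (le_lt_trans (ler_norm _) (archi_boundP (normr_ge0 _))).
have := H n; rewrite ler_pdivlMr ?exprn_gt0//.
have n4 : n%:R <= 4 ^+ n :> R.
  by rewrite -natrX ler_nat ltnW// ltn_expl.
move: nC; rewrite ltr_pdivrMr// => nC.
have : n%:R * x <= 4 ^+ n * x by rewrite ler_pM2r.
by lra.
Qed.

Section semi_inner_product.
Context (R : realType).

(* Not definite: elements of L^2 are represented by functions, so that
   [ip f f = 0] only means that [f] vanishes almost everywhere. *)
Record semi_inner_product (V : lmodType R) (ip : V -> V -> R) : Prop := {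
  sipC : forall x y, ip x y = ip y x ;
  sipP : forall a x y z, ip (a *: x + y) z = a * ip x z + ip y z ;
  sip_ge0 : forall x, 0 <= ip x x }.

(* Testing only rapidly Cauchy sequences is enough for projections, and is what
   the proof of Riesz-Fischer needs. *)
Definition sip_complete (V : lmodType R) (ip : V -> V -> R) : Prop :=
  forall (u : nat -> V) (C : R),
    (forall n m, (n <= m)%N -> ip (u n - u m) (u n - u m) <= C / 4 ^+ n) ->
    exists x (C' : R), forall n, ip (u n - x) (u n - x) <= C' / 4 ^+ n.

Definition linear_subspace (V : lmodType R) (M : V -> Prop) : Prop :=
  M 0 /\ forall a x y, M x -> M y -> M (a *: x + y).

Section theory.
Context (V : lmodType R) (ip : V -> V -> R) (ipP : semi_inner_product ip).

Lemma sipDl x y z : ip (x + y) z = ip x z + ip y z.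
Proof. by rewrite -[x]scale1r sipP// mul1r scale1r. Qed.

Lemma sip0l z : ip 0 z = 0.
Proof. by have := sipDl 0 0 z; rewrite addr0; lra. Qed.

Lemma sipZl a x z : ip (a *: x) z = a * ip x z.
Proof. by rewrite -[a *: x]addr0 sipP// sip0l addr0. Qed.

Lemma sipNl x z : ip (- x) z = - ip x z.
Proof. by rewrite -scaleN1r sipZl mulN1r. Qed.

Lemma sipDr x y z : ip z (x + y) = ip z x + ip z y.
Proof. by rewrite !(sipC ipP z) sipDl. Qed.

Lemma sip0r z : ip z 0 = 0.
Proof. by rewrite sipC// sip0l. Qed.

Lemma sipZr a x z : ip z (a *: x) = a * ip z x.
Proof. by rewrite !(sipC ipP z) sipZl. Qed.

Lemma sipNr x z : ip z (- x) = - ip z x.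
Proof. by rewrite !(sipC ipP z) sipNl. Qed.

Definition sipE := (sipDl, sipDr, sipNl, sipNr, sipZl, sipZr, sip0l, sip0r).

Lemma sip_CauchySchwarz x y : ip x y ^+ 2 <= ip x x * ip y y.
Proof.
apply: discriminant_le => [|t]; first exact: sip_ge0.
have := sip_ge0 ipP (y + t *: x).
by rewrite !sipE (sipC ipP y x); lra.
Qed.

Lemma sip_sqD_le x y : ip (x + y) (x + y) <= 2 * ip x x + 2 * ip y y.
Proof.
by have := sip_ge0 ipP (x - y); rewrite !sipE (sipC ipP y x); lra.
Qed.

(** [M] may fail to be closed: [p] is only a limit of elements of [M], so orthogonality to [p]
    itself is a separate clause. *)
Lemma sip_projection (M : V -> Prop) (a : V) :
  sip_complete ip -> linear_subspace M ->
  exists p, [/\ forall m, M m -> ip (a - p) m = 0, ip (a - p) p = 0 &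
                forall e, 0 < e -> exists2 m, M m & ip (p - m) (p - m) < e].
Proof.
move=> cplt [M0 ML].
pose A := [set ip (a - m) (a - m) | m in M].
have A0 : lbound A 0 by move=> _ [m _ <-]; exact: sip_ge0.
have iA : has_inf A by split; [exists (ip (a - 0) (a - 0)), 0|exists 0].
pose dd := inf A.
have dle m : M m -> dd <= ip (a - m) (a - m).
  by move=> Mm; apply: ge_inf; [exists 0|exists m].
have e4 n : 0 < (4 ^+ n)^-1 :> R by rewrite invr_gt0 exprn_gt0.
have /choice[u uP] n : exists m, M m /\ ip (a - m) (a - m) <= dd + (4 ^+ n)^-1.
  have [_ [m Mm <-] /ltW mlt] := inf_adherent (e4 n) iA.
  by exists m.
have MN x y : M x -> M y -> M (x + y).
  by move=> Mx My; rewrite -[x]scale1r; exact: ML.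
have MZ c x : M x -> M (c *: x) by move=> Mx; rewrite -[c *: x]addr0; exact: ML.
(* Parallelogram identity at the midpoint of [u n] and [u m]: their squared distance is at most
   [2 / 4 ^+ n + 2 / 4 ^+ m], hence the constant [4]. *)
have [|p [C pP]] := cplt u 4.
  move=> n m nm.
  have [Mn un] := uP n; have [Mm um] := uP m.
  have := dle _ (MZ (2^-1) _ (MN _ _ Mn Mm)).
  have le4 : (4 ^+ m)^-1 <= (4 ^+ n)^-1 :> R.
    by rewrite lef_pV2 ?posrE ?exprn_gt0// ler_weXn2l//; lra.
  move: un um; rewrite !sipE (sipC ipP _ a) (sipC ipP (u m) a).
  by rewrite (sipC ipP (u m) (u n)); lra.
have orth m : M m -> ip (a - p) m = 0.
  move=> Mm; apply/eqP; rewrite -sqrf_eq0 eq_le sqr_ge0 andbT.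
  apply: (@le0_geometric _ _ (2 * (1 + C) * ip m m)) => n.
  have [Mn un] := uP n.
  (* Near-minimality of [u n] against [u n - t m] makes a quadratic in [t] with constant term
     [(4 ^+ n)^-1] nonnegative. *)
  have aum : ip (a - u n) m ^+ 2 <= ip m m * (4 ^+ n)^-1.
    apply: discriminant_le => [|t]; first exact: sip_ge0.
    have := dle _ (MN _ _ Mn (MZ (- t) _ Mm)).
    by move: un; rewrite !sipE !(sipC ipP _ a) (sipC ipP m (u n)); lra.
  have upm := sip_CauchySchwarz (u n - p) m.
  have := ler_wpM2r (sip_ge0 ipP m) (pP n).
  have -> : ip (a - p) m = ip (a - u n) m + ip (u n - p) m by rewrite !sipE; lra.
  have := sqr_ge0 (ip (a - u n) m - ip (u n - p) m).
  by rewrite !expr2 in aum upm *; lra.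
have apx e : 0 < e -> exists2 m, M m & ip (p - m) (p - m) < e.
  move=> e0; apply: contrapT => H.
  have {}H n : e <= C / 4 ^+ n.
    rewrite leNgt; apply/negP => ne; apply: H; exists (u n); first by case: (uP n).
    apply: le_lt_trans ne; apply: le_trans (pP n).
    by rewrite !sipE (sipC ipP p); lra.
  by move: (le0_geometric H); rewrite leNgt e0.
exists p; split => //.
apply/eqP; rewrite -sqrf_eq0 eq_le sqr_ge0 andbT.
apply/ler_addgt0Pr => e e0; rewrite add0r.
have D0 := sip_ge0 ipP (a - p).
have [|m Mm] := apx (e / (ip (a - p) (a - p) + 1)).
  by rewrite divr_gt0// ltr_wpDl.
rewrite ltr_pdivlMr; last lra.
move=> pm; have := sip_CauchySchwarz (a - p) (p - m).
rewrite (_ : ip (a - p) (p - m) = ip (a - p) p); last first.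
  by rewrite sipDr sipNr (orth _ Mm) subr0.
by move: (sip_ge0 ipP (p - m)) => ?; nra.
Qed.

End theory.
End semi_inner_product.

(** * Self-adjoint relations *)

Section weighted_product.
Context (R : realType) (V : lmodType R) (ip : V -> V -> R).
Context (ipP : semi_inner_product ip) (c : R) (c0 : 0 < c).

Definition weighted_ip (x y : (V * V)%type) : R := c * ip x.1 y.1 + ip x.2 y.2.

Lemma weighted_ipP : semi_inner_product weighted_ip.
Proof.
split => [x y|a x y z|x]; rewrite /weighted_ip.
- by rewrite !(sipC ipP x.1, sipC ipP x.2).
- by rewrite /= !(sipE ipP); lra.
- by rewrite addr_ge0 ?(sip_ge0 ipP)// mulr_ge0 ?(sip_ge0 ipP)// ltW.
Qed.

Lemma weighted_ip_complete : sip_complete ip -> sip_complete weighted_ip.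
Proof.
move=> cplt u C uC.
have [|x [C1 xC]] := cplt (fun n => (u n).1) (C / c).
  move=> n m nm; rewrite -mulrAC ler_pdivlMr// mulrC.
  apply: le_trans (uC _ _ nm).
  by rewrite /weighted_ip lerDl (sip_ge0 ipP).
have [|y [C2 yC]] := cplt (fun n => (u n).2) C.
  move=> n m nm; apply: le_trans (uC _ _ nm).
  by rewrite /weighted_ip lerDr mulr_ge0 ?(sip_ge0 ipP)// ltW.
exists (x, y), (c * C1 + C2) => n.
rewrite mulrDl -mulrA; apply: lerD; last exact: yC.
by apply: ler_wpM2l; [exact: ltW|exact: xC].
Qed.

End weighted_product.

Section self_adjoint_relation.
Context (R : realType) (V : lmodType R) (ip : V -> V -> R).
Context (ipP : semi_inner_product ip) (ip_complete : sip_complete ip).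
(* The graph of the generator: [G f g] means that [f] is in the domain and that
   [g] represents [L f]. *)
Context (G : V -> V -> Prop).
(** [G] equals its own adjoint: linearity, symmetry and closedness all follow from this
    equivalence. *)
Hypothesis G_adj :
  forall f g, G f g <-> forall f' g', G f' g' -> ip f g' = ip g f'.

Lemma graph_symmetric f g f' g' : G f g -> G f' g' -> ip f g' = ip g f'.
Proof. by move=> /G_adj; exact. Qed.

Lemma graph_lin a f g f' g' : G f g -> G f' g' -> G (a *: f + f') (a *: g + g').
Proof.
move=> /G_adj fg /G_adj fg'; apply/G_adj => x y xy.
by rewrite !(sipE ipP) (fg _ _ xy) (fg' _ _ xy).
Qed.

Lemma graph0 : G 0 0.
Proof. by apply/G_adj => x y xy; rewrite !(sipE ipP). Qed.

Lemma graphZ a f g : G f g -> G (a *: f) (a *: g).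
Proof. by move=> fg; have := graph_lin a fg graph0; rewrite !addr0. Qed.

Lemma graphD f g f' g' : G f g -> G f' g' -> G (f + f') (g + g').
Proof. by move=> fg fg'; have := graph_lin 1 fg fg'; rewrite !scale1r. Qed.

Lemma graphB f g f' g' : G f g -> G f' g' -> G (f - f') (g - g').
Proof.
by move=> fg /(graphZ (-1)) fg'; have := graphD fg fg'; rewrite !scaleN1r.
Qed.

Lemma graph_subspace : linear_subspace (fun z : (V * V)%type => G z.1 z.2).
Proof.
split; first exact: graph0.
by move=> a [f g] [f' g']; exact: graph_lin.
Qed.

Lemma range_subspace : linear_subspace (fun h => exists g, G g h).
Proof.
split; first by exists 0; exact: graph0.
by move=> a x y [g gx] [h hy]; exists (a *: g + h); exact: graph_lin.
Qed.

(** The residual [f - p] is orthogonal to the range, so it lies in the kernel of the adjoint, which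
    is the kernel of [G]. Then [f] is orthogonal to it, and so is [p]: its norm is zero. *)
Lemma range_dense f : (forall z, G z 0 -> ip f z = 0) ->
  forall e, 0 < e -> exists g h, G g h /\ ip (f - h) (f - h) < e.
Proof.
move=> fker e e0.
have [p [orth orthp apx]] := sip_projection ipP f ip_complete range_subspace.
have /fker fp : G (f - p) 0.
  by apply/G_adj => f' g' fg'; rewrite orth ?(sip0l ipP)//; exists f'.
have fp0 : ip (f - p) (f - p) = 0.
  by rewrite (sipDr ipP) (sipNr ipP) orthp subr0 (sipC ipP).
have [|h [g gh] ph] := apx (e / 2); first by rewrite divr_gt0.
exists g, h; split => //; rewrite -(subrKA p).
by apply: le_lt_trans (sip_sqD_le ipP _ _) _; rewrite fp0; lra.
Qed.

Hypothesis G_neg : forall f g, G f g -> ip f g <= 0.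

Lemma regularized_range f l e : G f l -> (forall z, G z 0 -> ip f z = 0) ->
  0 < e -> exists g h m, [/\ G g h, G h m, ip (f - h) (f - h) <= e
                           & - ip h m <= - ip f l].
Proof.
move=> fl fker e0.
have [|g0 [h0 [gh0 fh0]]] := range_dense fker (e := e / 2).
  by rewrite divr_gt0.
have g00 := sip_ge0 ipP g0.
(* Small enough that the competitor [(g0, h0)] is within squared weighted distance [e] of
   [(0, f)]. *)
pose c := e / 2 / (ip g0 g0 + 1).
have c0 : 0 < c by rewrite !divr_gt0// ltr_wpDl.
have cg0 : c * ip g0 g0 <= e / 2.
  by rewrite /c mulrAC ler_pdivrMr ?ltr_wpDl// ler_wpM2l ?divr_ge0 ?ltW//; lra.
have wP := weighted_ipP ipP c0.
have [[g h] [orth orthp apx]] := sip_projection wP (0, f)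
  (weighted_ip_complete ipP c0 ip_complete) graph_subspace.
pose b := f - h.
(* Orthogonality to the graph reads [ip b g' = c * ip g f'], which is the adjoint criterion for
   [L b = c g]. *)
have bg : G b (c *: g).
  apply/G_adj => f' g' fg'; have := orth (f', g') fg'.
  by rewrite /weighted_ip/= -/b !(sipE ipP); lra.
(* Closedness of [G]: [(g, h)] is approximated by graph points [(x, y)], for which the adjoint
   identity holds exactly. The square of the defect is at most [2 K] times the squared weighted
   distance. *)
have gh : G g h.
  apply/G_adj => f' g' fg'; apply/eqP; rewrite -subr_eq0 -sqrf_eq0 eq_le.
  rewrite sqr_ge0 andbT; apply/ler_addgt0Pr => d d0; rewrite add0r.
  pose K := ip g' g' / c + ip f' f'.
  have K0 : 0 <= K.
    apply: addr_ge0; last exact: sip_ge0.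
    by apply: divr_ge0; [exact: sip_ge0|exact: ltW].
  have [|[x y] /= xy] := apx (d / 2 / (K + 1)).
    by rewrite divr_gt0 ?divr_gt0// ltr_wpDl.
  rewrite ltr_pdivlMr ?ltr_wpDl// /weighted_ip/= => H.
  have -> : ip g g' - ip h f' = ip (g - x) g' - ip (h - y) f'.
    by rewrite !(sipE ipP) (graph_symmetric xy fg'); lra.
  have A := sip_CauchySchwarz ipP (g - x) g'.
  have B := sip_CauchySchwarz ipP (h - y) f'.
  have := sqr_ge0 (ip (g - x) g' + ip (h - y) f').
  have X0 := sip_ge0 ipP (g - x); have Y0 := sip_ge0 ipP (h - y).
  have F0 := sip_ge0 ipP f'; have G0 := sip_ge0 ipP g'.
  have XK : ip (g - x) (g - x) * ip g' g' <= c * ip (g - x) (g - x) * K.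
    rewrite -mulrA mulrCA ler_wpM2l// mulrDr mulrCA divff ?gt_eqF// mulr1.
    by rewrite lerDl mulr_ge0// ltW.
  have YK : ip (h - y) (h - y) * ip f' f' <= ip (h - y) (h - y) * K.
    by rewrite ler_wpM2l// lerDr divr_ge0// ltW.
  have cX : 0 <= c * ip (g - x) (g - x) by rewrite mulr_ge0// ltW.
  by rewrite !expr2 in A B *; lra.
have hm : G h (l - c *: g).
  by rewrite -[h](subKr f); exact: graphB.
exists g, h, (l - c *: g); split => //.
(* The projection is at least as close to [(0, f)] as [(g0, h0)] is. *)
- have := orth (g0 - g, h0 - h) (graphB gh0 gh).
  have := sip_ge0 wP ((g, h) - (g0, h0)).
  have := mulr_ge0 (ltW c0) (sip_ge0 ipP g).
  move: fh0; rewrite /weighted_ip/= !(sipE ipP) !(sipC ipP _ f).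
  by rewrite (sipC ipP h0 h) (sipC ipP g0 g); lra.
(* Expand [E(h + b, h + b)]: both [E(b, b)] and the cross term are nonnegative. *)
- have := graph_symmetric bg hm; have := G_neg bg.
  have := mulr_ge0_le0 (ltW c0) (G_neg gh).
  by rewrite /b !(sipE ipP) (sipC ipP h g); lra.
Qed.

Lemma poincare_range k g h m : 0 <= k ->
  (forall f l, G f l -> k * - ip f l <= ip l l) ->
  G g h -> G h m -> k * ip h h <= - ip h m.
Proof.
move=> k0 gap gh hm.
(* Cauchy-Schwarz for [E], from its nonnegativity at [g - t h]; symmetry turns [ip g m] into
   [ip h h]. *)
have CS : ip h h ^+ 2 <= - ip h m * - ip g h.
  apply: discriminant_le => [|t]; first by rewrite oppr_ge0 G_neg.
  have := G_neg (graph_lin (- t) hm gh).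
  by rewrite !(sipE ipP) (graph_symmetric gh hm); lra.
have [h0|h0] := leP (ip h h) 0.
  by rewrite (@le_trans _ _ 0)// ?oppr_ge0 ?G_neg// mulr_ge0_le0.
have E0 := G_neg gh; have E1 := G_neg hm; have := gap _ _ gh.
move=> kg; rewrite -(ler_pM2r h0) -mulrA -expr2.
by apply: le_trans (ler_wpM2l k0 CS) _; rewrite mulrCA ler_wpM2l// oppr_ge0.
Qed.

Lemma poincare_of_second_order k f l : 0 <= k ->
  (forall f l, G f l -> k * - ip f l <= ip l l) ->
  G f l -> (forall z, G z 0 -> ip f z = 0) -> k * ip f f <= - ip f l.
Proof.
move=> k0 gap fl fker; set E := - ip f l.
have E0 : 0 <= E by rewrite oppr_ge0 G_neg.
apply/ler_addgt0Pr => e e0.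
(* The total error will be [s * (E + k + k * s)], at most [s * (E + 2 * k)] since [s <= 1]. *)
pose s := e / (e + (E + 2 * k + 1)).
have s0 : 0 < s by rewrite divr_gt0//; lra.
have s1 : s <= 1 by rewrite ler_pdivrMr; lra.
have sE : s * (E + 2 * k) <= e.
  by rewrite /s mulrAC ler_pdivrMr; nra.
have [|g [h [m [gh hm fh hE]]]] := regularized_range fl fker (e := s ^+ 2).
  exact: exprn_gt0.
have kh := poincare_range k0 gap gh hm.
(* Young's inequality with weight [s]: the factor [1 + 1 / s] multiplies a squared distance of at
   most [s ^+ 2]. *)
have ff : ip f f <= (1 + s) * ip h h + s * (1 + s).
  rewrite -(ler_pM2l s0).
  have := sip_ge0 ipP (s *: h - (f - h)); have := ler_wpM2l (ltW s0) fh.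
  move: fh; rewrite !(sipE ipP) (sipC ipP h f) !expr2; lra.
have := ler_wpM2l k0 ff.
have s10 : 0 <= 1 + s by lra.
have := ler_wpM2l s10 (le_trans kh hE).
have : s * (k * s) <= s * k by rewrite ler_pM2l// ler_piMr.
by rewrite -/E; lra.
Qed.
End self_adjoint_relation.

(** * Completeness of L^2 *)

Section L2.
Context d (T : measurableType d) (R : realType).
Context (mu : {measure set T -> \bar R}).

(** Comparison with a geometric series of ratio [1 / sqrt 2]. *)
Lemma cvg_series_sqr_le (v : nat -> R) (W : R) :
  (forall n, 2 ^+ n * v n ^+ 2 <= W) -> cvgn (series v).
Proof.
move=> vW; apply: normed_cvg.
have W0 : 0 <= W by apply: le_trans (vW 0%N); rewrite expr0 mul1r sqr_ge0.
pose r : R := Num.sqrt (2^-1).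
apply: (@series_le_cvg _ (fun n => `|v n|) (geometric (Num.sqrt W) r)) => [n|n|n|].
- exact: normr_ge0.
- by rewrite /= mulr_ge0 ?exprn_ge0 ?sqrtr_ge0.
- rewrite -(@ler_pXn2r _ 2%N) ?nnegrE ?mulr_ge0 ?exprn_ge0 ?sqrtr_ge0//.
  rewrite exprMn -exprM mulnC exprM !sqr_sqrtr ?invr_ge0// exprVn.
  by rewrite real_normK ?num_real// ler_pdivlMr ?exprn_gt0// mulrC.
- suff : `|r| < 1 by exact: is_cvg_geometric_series.
  rewrite ger0_norm ?sqrtr_ge0//.
  by rewrite -[ltRHS]sqrtr1 ltr_sqrt// invf_lt1//; lra.
Qed.

(** The weights [2 ^+ n] leave the integrals of [2 ^+ n * v n ^+ 2] summable, so the sum [W] is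
    finite almost everywhere; where it is, it bounds every term. *)
Lemma ae_cvg_series (v : nat -> T -> R) (C : R) :
  (forall n, measurable_fun setT (v n)) ->
  (forall n, (\int[mu]_x (v n x ^+ 2)%:E <= (C / 4 ^+ n)%:E)%E) ->
  exists A, [/\ measurable A, mu (~` A) = 0%E &
                forall x, A x -> cvgn (series (v ^~ x))].
Proof.
move=> mv vC.
pose w n x : \bar R := (2 ^+ n * v n x ^+ 2)%:E.
have w0 n x : (0 <= w n x)%E by rewrite lee_fin mulr_ge0 ?sqr_ge0 ?exprn_ge0.
have mv2 n : measurable_fun setT (fun x => (v n x ^+ 2)%:E).
  by apply/measurable_EFinP; exact: measurable_funX.
have mw n : measurable_fun setT (w n).
  by apply/measurable_EFinP; apply: measurable_funM => //; exact: measurable_funX.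
pose W x := (\sum_(n <oo) w n x)%E.
have W0 x : (0 <= W x)%E by apply: nneseries_ge0.
have mW : measurable_fun setT W.
  by apply: ge0_emeasurable_sum.
have C0 : 0 <= C.
  rewrite -[C]divr1 -[1](expr0 4) -lee_fin; apply: le_trans (vC 0%N).
  by apply: integral_ge0 => x _; rewrite lee_fin sqr_ge0.
have iW : mu.-integrable setT W.
  apply/integrableP; split => //.
  under eq_integral do rewrite gee0_abs//.
  rewrite integral_nneseries//.
  apply: (@le_lt_trans _ _ (2 * C)%:E); last exact: ltry.
  (* The [n]-th integral is at most [C / 2 ^+ n], written as [2 * C / 2 ^+ n.+1]. *)
  apply: le_trans (epsilon_trick0 xpredT _); last by rewrite mulr_ge0.
  apply: lee_nneseries => [n _ _|n _]; first exact: integral_ge0.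
  rewrite /w; under eq_integral do rewrite EFinM.
  rewrite ge0_integralZl_EFin ?exprn_ge0//; last first.
    by move=> x _; rewrite lee_fin sqr_ge0.
  apply: le_trans (lee_wpmul2l _ (vC n)) _; first by rewrite lee_fin exprn_ge0.
  rewrite -EFinM lee_fin natrX exprS.
  have -> : 4 ^+ n = 2 ^+ n * 2 ^+ n :> R by rewrite -exprMn -natrM.
  by rewrite le_eqVlt; apply/orP; left; apply/eqP; field; rewrite expf_neq0.
exists [set x | W x \is a fin_num]; split.
- by rewrite -[X in measurable X]setTI; exact: emeasurable_fin_num.
- apply: measure_negligible.
    apply: measurableC; rewrite -[X in measurable X]setTI.
    exact: emeasurable_fin_num.
  have := integrable_ae measurableT iW.
  by apply: filterS => x /(_ I).
- move=> x /= Wx; apply: (@cvg_series_sqr_le _ (fine (W x))) => n.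
  rewrite -lee_fin fineK//.
  apply: le_trans (@nneseries_lim_ge _ (w ^~ x) xpredT 0 n.+1 _); last first.
    by move=> *.
  by rewrite big_nat_recr//= leeDr// sume_ge0.
Qed.

Lemma Lfun2_sqr (f : T -> R) : measurable_fun setT f ->
  (\int[mu]_x (f x ^+ 2)%:E < +oo)%E -> f \in Lfun mu 2%:E.
Proof.
move=> mf iff; rewrite inE; apply/andP; split; rewrite inE//=.
rewrite /finite_norm unlock /Lnorm poweR_lty//.
under eq_integral => x _ do rewrite /= powR_mulrn// real_normK ?num_real//.
by [].
Qed.

Local Notation L2 := (LfunType mu (@lee1n R 2)).

Definition L2_ip (f g : L2) : R := \int[mu]_x (f x * g x).

Lemma L2_mul_integrable (f g : L2) :
  mu.-integrable setT (EFin \o (fun x => f x * g x)).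
Proof. by apply/Lfun1_integrable/Lfun2_mul_Lfun1; exact: LfunP. Qed.

Lemma L2_ipP : semi_inner_product L2_ip.
Proof.
split => [f g|a f g h|f]; rewrite /L2_ip.
- by apply: eq_Rintegral => x _; rewrite mulrC.
- have fh := L2_mul_integrable f h; have gh := L2_mul_integrable g h.
  rewrite -RintegralZl// -RintegralD//; last first.
    by apply: (integrableZl measurableT a fh).
  by apply: eq_Rintegral => x _; rewrite mulrA -mulrDl.
- by apply: Rintegral_ge0 => x _; rewrite -expr2 sqr_ge0.
Qed.

Lemma L2_ip_sqr (f : L2) : (\int[mu]_x (f x ^+ 2)%:E)%E = (L2_ip f f)%:E.
Proof.
rewrite /L2_ip /Rintegral fineK; first exact: eq_integral.
by apply: integrable_fin_num => //; exact: L2_mul_integrable.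
Qed.

Lemma measurable_L2 (f : L2) : measurable_fun setT f.
Proof. exact: measurable_funPT. Qed.

Lemma L2_complete : sip_complete L2_ip.
Proof.
move=> u C uC.
have mu_ n : measurable_fun setT (u n : T -> R) by exact: measurable_L2.
have uCE n m : (n <= m)%N ->
    (\int[mu]_x ((u n x - u m x) ^+ 2)%:E <= (C / 4 ^+ n)%:E)%E.
  by move=> nm; rewrite (L2_ip_sqr (u n - u m)) lee_fin; exact: uC.
have [||A [mA A0 Acvg]] :=
    @ae_cvg_series (fun n x => u n.+1 x - u n x) C.
- by move=> n; exact: measurable_funB.
- move=> n; apply: le_trans (uCE _ _ (leqnSn n)).
  by rewrite le_eqVlt; apply/orP; left; apply/eqP; apply: eq_integral => x _;
    rewrite -sqrrN opprB.
(* Cutting off outside [A] makes the sequence converge everywhere, so its limit is measurable. *)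
pose h n x := u n x * \1_A x.
have mh n : measurable_fun setT (h n).
  by apply: measurable_funM => //; exact: measurable_indic.
pose g x := limn (h ^~ x).
have hg x : h ^~ x @ \oo --> g x.
  suff : cvgn (h ^~ x) by [].
  have [Ax|nAx] := pselect (A x).
    have -> : h ^~ x = (fun n => u 0%N x + series (fun k => u k.+1 x - u k x) n).
      apply/funext => n; rewrite /h indicE mem_set// mulr1.
      exact: (eq_sum_telescope (fun k => u k x)).
    by apply: is_cvgD; [exact: is_cvg_cst|exact: Acvg].
  have -> : h ^~ x = cst 0.
    by apply/funext => n; rewrite /h indicE memNset// mulr0.
  exact: is_cvg_cst.
have mg : measurable_fun setT g.
  by apply: (measurable_fun_cvg mh) => x _; exact: hg.
have hgC n : (\int[mu]_x ((h n x - g x) ^+ 2)%:E <= (C / 4 ^+ n)%:E)%E.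
  pose f m x := ((h n x - h m x) ^+ 2)%:E.
  have mf m : measurable_fun setT (f m).
    by apply/measurable_EFinP; apply: measurable_funX; exact: measurable_funB.
  have f0 m x : setT x -> (0 <= f m x)%E by rewrite lee_fin sqr_ge0.
  rewrite (_ : (\int[mu]_x _)%E = (\int[mu]_x limn_einf (f ^~ x))%E); last first.
    apply: eq_integral => x _; apply/esym.
    suff /cvg_limn_einf_sup[] : f ^~ x @ \oo --> ((h n x - g x) ^+ 2)%:E by [].
    apply: cvg_EFin; first exact: nearW.
    have hB : h n x - h m x @[m --> \oo] --> h n x - g x.
      by apply: cvgB; [exact: cvg_cst|exact: hg].
    exact: (cvgM hB hB).
  apply: le_trans (fatou mu measurableT mf f0) _.
  rewrite limn_einf_lim; apply: lime_le; first exact: is_cvg_einfs.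
  (* The infimum over indices from [k] on is tested at [maxn n k], where the Cauchy bound also
     applies. *)
  apply: nearW => k; apply: (@le_trans _ _ (\int[mu]_x f (maxn n k) x)%E).
    by apply: ereal_inf_lbound; exists (maxn n k) => //=; exact: leq_maxr.
  apply: le_trans (uCE _ _ (leq_maxl n k)).
  apply: ge0_le_integral => //.
  - by move=> x _; rewrite lee_fin sqr_ge0.
  - by apply/measurable_EFinP; apply: measurable_funX; exact: measurable_funB.
  - by move=> x _; rewrite lee_fin /h -mulrBl exprMn ler_piMr ?sqr_ge0//.
have ugC n : (\int[mu]_x ((u n x - g x) ^+ 2)%:E <= (C / 4 ^+ n)%:E)%E.
  apply: le_trans (hgC n); rewrite le_eqVlt; apply/orP; left; apply/eqP.
  apply: ae_eq_integral => //.
  - by apply/measurable_EFinP; apply: measurable_funX; exact: measurable_funB.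
  - by apply/measurable_EFinP; apply: measurable_funX; exact: measurable_funB.
  - exists (~` A); split => //; first exact: measurableC.
    move=> x /= H Ax; apply: H => _.
    by rewrite /h indicE mem_set// mulr1.
have dL : (fun x => u 0%N x - g x) \in Lfun mu 2%:E.
  apply: Lfun2_sqr; first exact: measurable_funB.
  by apply: le_lt_trans (ugC 0%N) _; exact: ltry.
(* The limit is [g], written as [u 0 - (u 0 - g)] because square integrability was obtained for
   [u 0 - g]. *)
exists (u 0%N - Lfun_Sub (@lee1n R 2) dL), C => n.
rewrite -lee_fin -L2_ip_sqr; apply: le_trans (ugC n).
rewrite le_eqVlt; apply/orP; left; apply/eqP; apply: eq_integral => x _.
by congr ((_ - _) ^+ 2)%:E; exact: subKr.
Qed.
End L2.

(** * Markov generators *)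

Section generator.
Context d (S : measurableType d) (R : realType) (nu : probability S R).
Local Notation L2 := (LfunType nu (@lee1n R 2)).
Local Notation toL2 := (@Lfun_Sub _ S R nu _ (@lee1n R 2) _).
Local Notation ip := (@L2_ip _ S R nu).

Lemma L2_ip_ae (f f' g : L2) : ae_eq nu setT f f' -> ip f g = ip f' g.
Proof.
move=> ff'; congr fine; apply: ae_eq_integral => //.
- by apply/measurable_EFinP; apply: measurable_funM; exact: measurable_L2.
- by apply/measurable_EFinP; apply: measurable_funM; exact: measurable_L2.
- by apply: filterS ff' => x /(_ I) /= -> _.
Qed.

Definition one_L2 : L2 := toL2 (Lfun_cst nu 1 2).

Lemma L2_ip_one (f : L2) : ip one_L2 f = mean nu f.
Proof. by apply: eq_Rintegral => x _; rewrite /= mul1r. Qed.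

Lemma L2_ip_one_one : ip one_L2 one_L2 = 1.
Proof.
rewrite L2_ip_one /mean Rintegral_cst// mul1r.
exact: (congr1 fine (probability_setT nu)).
Qed.

Lemma cov_L2 (f : L2) : cov nu f f =
  ip (f - mean nu f *: one_L2) (f - mean nu f *: one_L2).
Proof.
rewrite !(sipE (L2_ipP nu)) (sipC (L2_ipP nu) f one_L2) L2_ip_one L2_ip_one_one.
by rewrite /cov -[mean nu (f \* f)]/(ip f f); ring.
Qed.

Context (D : set (S -> R)) (L : (S -> R) -> S -> R).
Context (L_markov : markov_generator nu D L).
Context (L_selfadjoint : self_adjoint nu D L).

Lemma domain_L2 f : D f -> f \in Lfun nu 2%:E.
Proof. by have [T _ [_ DL]] := L_markov; move=> /DL[]. Qed.

Lemma generator_L2 f : D f -> L f \in Lfun nu 2%:E.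
Proof. by have [T _ [_ DL]] := L_markov; move=> /DL[]. Qed.

(** The adjoint graph is insensitive to null sets; self-adjointness identifies it with the graph of
    [L] up to a.e. equality. *)
Definition generator_graph (f g : L2) : Prop := adjoint_graph nu D L f g.

Lemma generator_graphP (f g : L2) :
  generator_graph f g <-> D f /\ ae_eq nu setT g (L f).
Proof.
rewrite /generator_graph; have [_ ->] := L_selfadjoint.
by split=> [[]//|[? ?]]; split => //; exact: LfunP.
Qed.

Lemma generator_graph_L f (Df : D f) :
  generator_graph (toL2 (domain_L2 Df)) (toL2 (generator_L2 Df)).
Proof. by apply/generator_graphP; split => //; exact: ae_eq_refl. Qed.

Lemma generator_graph_adj f g : generator_graph f g <->
  forall f' g', generator_graph f' g' -> ip f g' = ip g f'.
Proof.
split=> [[_ _ fg] f' g' /generator_graphP[Df' g'L]|fg].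
  rewrite -[RHS](fg _ Df') (sipC (L2_ipP nu)).
  rewrite (L2_ip_ae (f' := toL2 (generator_L2 Df')))// (sipC (L2_ipP nu)).
  by [].
split; [exact: LfunP|exact: LfunP|] => h Dh.
exact: (fg _ _ (generator_graph_L Dh)).
Qed.

(* The bound [nu[(T_t f - f) / t * h] <= 0] passes to the limit; stated for every
   [T] because [markov_generator] hides the semigroup. *)
Lemma generator_mean_le0 (f h : L2) : D f ->
  (forall T t, 0 < t -> markov_semigroup nu T ->
     mean nu (T t f \* h) <= mean nu (f \* h)) ->
  mean nu (L f \* h) <= 0.
Proof.
move=> Df; have [T Tms [_ DL]] := L_markov; have [_ _ cvgL] := DL _ Df.
move=> /(_ T) Tle; set lf : L2 := toL2 (generator_L2 Df).
rewrite -[mean _ _]/(ip lf h) leNgt; apply/negP => a0.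
have h0 := sip_ge0 (L2_ipP nu) h.
(* If [a = ip lf h] were positive, the error [q] of the difference quotient would satisfy
   [ip q h <= - a]; this threshold on [|q| ^ 2] then contradicts Cauchy-Schwarz. *)
have [t [t0 tlt]] : exists t, 0 < t /\
    sqnorm nu (fun x => (T t f x - f x) / t - L f x) <
    ip lf h ^+ 2 / (ip h h + 1).
  apply: (@filter_ex _ (0^'+)); apply: filterI; first exact: nbhs_right_gt.
  by apply: (cvgr_lt _ cvgL); rewrite divr_gt0 ?exprn_gt0// ltr_wpDl.
pose Tf : L2 := toL2 (ms_L2 Tms (ltW t0) (LfunP f)).
pose q : L2 := t^-1 *: (Tf - f) - lf.
have qE : sqnorm nu (fun x => (T t f x - f x) / t - L f x) = ip q q.
  by apply: eq_Rintegral => x _; rewrite -expr2 /q [_ / t]mulrC.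
move: tlt; rewrite qE ltr_pdivlMr ?ltr_wpDl// => qlt.
have CS := sip_CauchySchwarz (L2_ipP nu) q h.
have qlf : ip q h <= - ip lf h.
  rewrite /q !(sipE (L2_ipP nu)) gerDr pmulr_rle0 ?invr_gt0// subr_le0.
  exact: Tle.
have q0 := sip_ge0 (L2_ipP nu) q.
have : ip lf h ^+ 2 <= ip q h ^+ 2.
  by rewrite -[leRHS]sqrrN; rewrite ler_sqr ?nnegrE; lra.
by lra.
Qed.


(** Contraction and Cauchy-Schwarz give [nu[f T_t f] <= nu[f ^ 2]]. *)
Lemma generator_graph_le0 f g : generator_graph f g -> ip f g <= 0.
Proof.
move=> /generator_graphP[Df gL]; rewrite (sipC (L2_ipP nu)).
rewrite (L2_ip_ae (f' := toL2 (generator_L2 Df)))//.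
apply: generator_mean_le0 => // T t t0 Tms.
pose Tf : L2 := toL2 (ms_L2 Tms (ltW t0) (LfunP f)).
rewrite -[leLHS]/(ip Tf f) -[leRHS]/(ip f f).
have CS := sip_CauchySchwarz (L2_ipP nu) Tf f.
have f0 := sip_ge0 (L2_ipP nu) f.
have : ip Tf Tf <= ip f f.
  by have := ms_contraction Tms (ltW t0) (LfunP f).
move=> /(ler_wpM2r f0)/(le_trans CS).
by rewrite leNgt => sq; apply/negP => lt; nra.
Qed.

(** Self-adjointness moves [T t] onto the constant [1], which it fixes. *)
Lemma mean_semigroup T t (f : L2) : markov_semigroup nu T -> 0 < t ->
  mean nu (T t f) = mean nu f.
Proof.
move=> Tms /ltW t0.
pose Tf : L2 := toL2 (ms_L2 Tms t0 (LfunP f)).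
have T1L : T t (cst 1) \in Lfun nu 2%:E by exact: ms_L2 (LfunP one_L2).
transitivity (ip one_L2 Tf); first by rewrite L2_ip_one.
rewrite (sipC (L2_ipP nu)) -[LHS]/(mean nu (T t f \* one_L2)).
rewrite (ms_selfadjoint Tms)//; [|exact: LfunP|exact: LfunP].
rewrite -[LHS]/(ip f (toL2 T1L)) (sipC (L2_ipP nu)) -L2_ip_one.
by apply: L2_ip_ae; exact: ms_one.
Qed.

(** Invariance of the mean allows [generator_mean_le0] with both test functions [1] and [-1], so
    [nu[L h] = 0] on the domain; this is the adjoint criterion for [L 1 = 0]. *)
Lemma generator_graph_one : generator_graph one_L2 0.
Proof.
split; [exact: LfunP|exact: LfunP|] => h Dh.
pose H := toL2 (domain_L2 Dh); pose LH := toL2 (generator_L2 Dh).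
rewrite -[LHS]/(ip one_L2 LH) -[RHS]/(ip 0 H) (sip0l (L2_ipP nu)).
rewrite (sipC (L2_ipP nu)).
have le0 (e : R) : ip LH (e *: one_L2) <= 0.
  apply: (@generator_mean_le0 H) => // T t t0 Tms.
  pose TH : L2 := toL2 (ms_L2 Tms (ltW t0) (LfunP H)).
  rewrite -[leLHS]/(ip TH (e *: one_L2)) -[leRHS]/(ip H (e *: one_L2)).
  rewrite !(sipZr (L2_ipP nu)) !(sipC (L2_ipP nu) _ one_L2) !L2_ip_one.
  by rewrite (mean_semigroup H Tms t0).
have := le0 1; have := le0 (-1).
by rewrite !(sipZr (L2_ipP nu)); lra.
Qed.

Lemma generator_graph_center f g :
  generator_graph f g -> generator_graph (f - mean nu f *: one_L2) g.
Proof.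
move=> fg; have := graphB (L2_ipP nu) generator_graph_adj fg
  (graphZ (L2_ipP nu) generator_graph_adj (mean nu f) generator_graph_one).
by rewrite scaler0 subr0.
Qed.

Lemma ip_center f g : generator_graph f g ->
  ip (f - mean nu f *: one_L2) g = ip f g.
Proof.
move=> fg; have := graph_symmetric generator_graph_adj generator_graph_one fg.
by rewrite !(sipE (L2_ipP nu)) => ->; rewrite mulr0 subr0.
Qed.

Lemma poincare_second_order k f : 0 <= k -> D f ->
  k * cov nu f f <= dirichlet nu L f ->
  k * dirichlet nu L f <= mean nu (fun x => L f x ^+ 2).
Proof.
move=> k0 Df kf.
pose F := toL2 (domain_L2 Df); pose LF := toL2 (generator_L2 Df).
have FL : generator_graph F LF := generator_graph_L Df.
have cE := ip_center FL; have neg := generator_graph_le0 FL.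
move: kf; rewrite (cov_L2 F).
rewrite -[dirichlet nu L f]/(- ip F LF).
rewrite -[mean nu (fun x => L f x ^+ 2)]/(ip LF LF).
set F0 := (_ - _) in cE * => kF.
have := sip_CauchySchwarz (L2_ipP nu) F0 LF; rewrite cE => CS.
have LF0 := sip_ge0 (L2_ipP nu) LF.
have [E0|E0] := leP (- ip F LF) 0; first by nra.
rewrite -(ler_pM2r E0) -mulrA.
apply: (@le_trans _ _ (k * (ip F0 F0 * ip LF LF))).
  by rewrite ler_wpM2l// mulrNN -expr2.
by rewrite mulrA [leRHS]mulrC ler_wpM2r.
Qed.

Lemma second_order_poincare k : ergodic nu D L -> 0 <= k ->
  (forall f, D f -> k * dirichlet nu L f <= mean nu (fun x => L f x ^+ 2)) ->
  forall f, D f -> k * cov nu f f <= dirichlet nu L f.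
Proof.
move=> erg k0 kP f Df.
pose F := toL2 (domain_L2 Df); pose LF := toL2 (generator_L2 Df).
have FL : generator_graph F LF := generator_graph_L Df.
rewrite (cov_L2 F) -[dirichlet nu L f]/(- ip F LF) -(ip_center FL).
apply: (poincare_of_second_order (L2_ipP nu) (@L2_complete _ _ _ nu)
  generator_graph_adj generator_graph_le0 k0 _ (generator_graph_center FL)).
- move=> {f Df F LF FL} f g /generator_graphP[Df gL].
  pose LF := toL2 (generator_L2 Df).
  rewrite (sipC (L2_ipP nu)) (L2_ip_ae f (f' := LF) gL).
  rewrite (L2_ip_ae g (f' := LF) gL) (sipC (L2_ipP nu) LF g).
  rewrite (L2_ip_ae LF (f' := LF) gL) (sipC (L2_ipP nu) LF f).
  exact: kP.
(* By ergodicity the kernel consists of constants, to which a centered function is orthogonal. *)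
- move=> z /generator_graphP[Dz z0].
  have [|c zc] := erg z Dz; first exact: ae_eq_sym.
  rewrite (sipC (L2_ipP nu)) (L2_ip_ae _ (f' := c *: one_L2)); last first.
    by apply: filterS zc => x /[apply] ->; exact: esym (mulr1 c).
  rewrite !(sipE (L2_ipP nu)) L2_ip_one_one L2_ip_one.
  by rewrite -[mean nu F]/(mean nu f); ring.
Qed.

End generator.

Theorem proposition1p1 (d : measure_display) (S : measurableType d)
    (R : realType) (nu : probability S R)
    (D : set (S -> R)) (L : (S -> R) -> S -> R)
    (L_markov : markov_generator nu D L)
    (L_selfadjoint : self_adjoint nu D L)
    (L_ergodic : ergodic nu D L) :
  largest_constant
    [set k : R | forall f, D f ->
       k * dirichlet nu L f <= mean nu (fun x => L f x ^+ 2)]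
    (spectral_gap nu D L).
Proof.
have E0 f : D f -> 0 <= dirichlet nu L f.
  move=> Df; rewrite oppr_ge0.
  exact: (generator_graph_le0 L_markov L_selfadjoint
    (generator_graph_L L_markov L_selfadjoint Df)).
have A1 : poincare_constants nu D L 0.
  by split=> // f Df; rewrite mul0r; exact: E0.
have [_ gapP] := spectral_gap_largest E0.
have sub : poincare_constants nu D L `<=` [set k : R | forall f, D f ->
    k * dirichlet nu L f <= mean nu (fun x => L f x ^+ 2)].
  move=> k [k0 kP] f Df.
  exact: (poincare_second_order L_markov L_selfadjoint k0 Df (kP f Df)).
split; last by move=> /gapP; exact: sub.
apply/eqP; rewrite eq_le; apply/andP; split; last first.
  by apply: ereal_sup_le; exact: image_subset.
apply: ge_ereal_sup => _ [k kP <-].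
(* Poincare constants are nonnegative by definition, so a negative [k] is compared with the constant
   [0] instead. *)
have [k0|k0] := leP 0 k.
  apply: ereal_sup_ubound; exists k => //; split=> //.
  exact: (second_order_poincare L_markov L_selfadjoint L_ergodic k0 kP).
apply: (@le_trans _ _ 0%E); first by rewrite lee_fin ltW.
by apply: ereal_sup_ubound; exists 0.
Qed.
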